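(* Let $F$ be a field of characteristic $p$, where $p$ is zero or a prime. Let $n_1,\ldots,n_k$ be positive integers not divisible by $p$, and let $\psi_1,\ldots,\psi_k$ be maps from $\mathbb{Z}$ to $F$ with periods $n_1,\ldots,n_k$ respectively (i.e. $\psi_s(x+n_s)=\psi_s(x)$ for all $x\in\mathbb{Z}$). Let $D=\bigcup_{s=1}^k D(n_s)$, where $D(n)$ denotes the set of positive divisors of $n$. If $\psi_1(x)+\cdots+\psi_k(x)=0$ for $\sum_{d\in D}\varphi(d)$ consecutive integers $x$, then $\psi_1(x)+\cdots+\psi_k(x)=0$ for all $x\in\mathbb{Z}$.
   Context: $\varphi$ is Euler's totient function. The period $n_s$ is not required to be the least period of $\psi_s$. When $p=0$ the condition ''not divisible by $p$'' is vacuous for positive integers. *)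

(* Defs.v *)
From mathcomp Require Import all_boot all_order all_algebra.

Set Implicit Arguments.
Unset Strict Implicit.
Unset Printing Implicit Defensive.

Import GRing.Theory.
Local Open Scope ring_scope.

(* [pchar F] contains only primes, so characteristic zero is its emptiness. *)
Definition has_characteristic (F : fieldType) (p : nat) : Prop :=
  if p == 0%N then [pchar F] =i pred0 else p \in [pchar F].

(* n is a period of f, not necessarily the least one. *)
Definition periodic (F : fieldType) (f : int -> F) (n : nat) : Prop :=
  forall x : int, f (x + n%:Z) = f x.

(* A duplicate-free enumeration of the union over s of the sets of positive
   divisors of n s; [divisors m] is that set only when m > 0. *)
Definition divisors_union (k : nat) (n : 'I_k -> nat) : seq nat :=
  undup (flatten [seq divisors (n s) | s <- enum 'I_k]).

(* Main.v *)
Require Import Defs.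
From HB Require Import structures.
From mathcomp Require Import all_boot all_order all_algebra.
From mathcomp Require Import cyclotomic.

(** A polynomial acts on functions int -> F by letting 'X be the shift
    f |-> f (_ + 1).  A function of period n is killed by 'X^n - 1, which is the
    product of the cyclotomic polynomials 'Phi_d over the divisors d of n.  Hence
    P := \prod_(d in D) 'Phi_d, where D is the set of all divisors of the n s and
    repeated divisors enter only once, is a multiple of every 'X^(n s) - 1 and
    kills every psi s, so also their sum f.  P is monic of degree N, the sum of
    the totients over D: f satisfies a linear recurrence of order N, and N
    consecutive zeros of f, from a on, propagate to all later integers.

    The propagation needs no induction: the value of f at a + m is the functional
    [shift_eval f a] at 'X^m.  This functional vanishes on the multiples of P
    ([shift_eval_sum_periodic]), and on polynomials of degree less than N by
    hypothesis, so it vanishes on 'X^m (divide 'X^m by P).  Integers below a are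
    reached because f has the positive period \prod_s n s. *)

Set Implicit Arguments.
Unset Strict Implicit.
Unset Printing Implicit Defensive.

Import GRing.Theory.
Local Open Scope ring_scope.

(** The value at a of the function obtained by letting p act on f through the
    shift operator; as a functional in p it sends 'X^m to f (a + m). *)
Definition shift_eval (F : fieldType) (f : int -> F) (a : int) (p : {poly F}) : F :=
  \sum_(i < size p) p`_i * f (a + i%:Z).

Lemma shift_eval_widen (F : fieldType) (f : int -> F) a (p : {poly F}) m :
  (size p <= m)%N -> shift_eval f a p = \sum_(i < m) p`_i * f (a + i%:Z).
Proof.
move=> le_pm; rewrite /shift_eval (big_ord_widen _ (fun i => p`_i * f (a + i%:Z)) le_pm).
rewrite big_mkcond; apply: eq_bigr => i _; case: ltnP => // le_pi.
by rewrite nth_default ?mul0r.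
Qed.

Lemma shift_eval_is_linear (F : fieldType) (f : int -> F) a :
  scalar (shift_eval f a).
Proof.
move=> c p q; pose m := maxn (size (c *: p + q)) (maxn (size p) (size q)).
rewrite !(@shift_eval_widen _ _ _ _ m) ?leq_max ?leqnn ?orbT // mulr_sumr -big_split.
by apply: eq_bigr => i _; rewrite coefD coefZ mulrDl mulrA.
Qed.

HB.instance Definition _ (F : fieldType) (f : int -> F) (a : int) :=
  GRing.isLinear.Build F {poly F} F *%R (shift_eval f a) (shift_eval_is_linear f a).

Lemma shift_eval_Xn (F : fieldType) (f : int -> F) a m :
  shift_eval f a 'X^m = f (a + m%:Z).
Proof.
rewrite /shift_eval size_polyXn big_ord_recr /= coefXn eqxx mul1r big1 ?add0r // => i _.
by rewrite coefXn ltn_eqF ?mul0r.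
Qed.

(** By linearity it suffices to test the multiples 'X^i * ('X^n - 1), whose
    values are the differences f (a + i + n) - f (a + i). *)
Lemma shift_eval_periodic (F : fieldType) (f : int -> F) a n (p : {poly F}) :
  periodic f n -> 'X^n - 1 %| p -> shift_eval f a p = 0.
Proof.
move=> f_per /dvdpP[q ->]; rewrite -[q]coefK poly_def mulr_suml linear_sum big1 // => i _.
rewrite -scalerAl linearZ mulrBr mulr1 -exprD linearB /= !shift_eval_Xn.
by rewrite PoszD addrA f_per subrr mulr0.
Qed.

Lemma shift_eval_sum (F : fieldType) k (psi : 'I_k -> int -> F) a p :
  shift_eval (fun x => \sum_(s < k) psi s x) a p = \sum_(s < k) shift_eval (psi s) a p.
Proof.
by rewrite /shift_eval exchange_big; apply: eq_bigr => i _; rewrite mulr_sumr.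
Qed.

Lemma shift_eval_sum_periodic (F : fieldType) k (n : 'I_k -> nat)
    (psi : 'I_k -> int -> F) a (p : {poly F}) :
  (forall s, periodic (psi s) (n s)) -> (forall s, 'X^(n s) - 1 %| p) ->
  shift_eval (fun x => \sum_(s < k) psi s x) a p = 0.
Proof.
move=> psi_per n_dvd; rewrite shift_eval_sum big1 // => s _.
exact: shift_eval_periodic (psi_per s) (n_dvd s).
Qed.

Lemma periodic_mulz (F : fieldType) (f : int -> F) n x (t : int) :
  periodic f n -> f (x + t * n%:Z) = f x.
Proof.
move=> f_per.
have per_nat y (j : nat) : f (y + j%:Z * n%:Z) = f y.
  elim: j => [|j IHj]; first by rewrite mul0r addr0.
  by rewrite -addn1 PoszD mulrDl mul1r addrA f_per.
case: t => j; first exact: per_nat.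
by rewrite -(per_nat _ j.+1) NegzE mulNr subrK.
Qed.

Lemma periodic_sum (F : fieldType) k (n : 'I_k -> nat) (psi : 'I_k -> int -> F) :
  (forall s, periodic (psi s) (n s)) ->
  periodic (fun x => \sum_(s < k) psi s x) (\prod_(s < k) n s).
Proof.
move=> psi_per x; apply: eq_bigr => s _.
by rewrite (bigD1 s) //= mulnC PoszM periodic_mulz.
Qed.

(** The product is formed over the integers before it is mapped to F, so that
    the integral factorization of 'X^n - 1 and the integral degrees carry over. *)
Definition Cyclotomic_prod (F : fieldType) (D : seq nat) : {poly F} :=
  map_poly intr (\prod_(d <- D) 'Phi_d).

Lemma size_Cyclotomic_prod (F : fieldType) (D : seq nat) :
  size (Cyclotomic_prod F D) = (\sum_(d <- D) totient d).+1.
Proof.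
have mon : \prod_(d <- D) 'Phi_d \is monic.
  by apply: monic_prod => d _; apply: Cyclotomic_monic.
rewrite /Cyclotomic_prod size_map_poly_id0; last first.
  by rewrite (monicP mon) rmorph1 oner_eq0.
elim: D {mon} => [|d D IHD]; first by rewrite !big_nil size_poly1.
rewrite !big_cons size_monicM ?Cyclotomic_monic //; last by rewrite -size_poly_gt0 IHD.
by rewrite IHD size_Cyclotomic addnS.
Qed.

Lemma Xn_sub_1_dvd_Cyclotomic_prod (F : fieldType) (D : seq nat) m :
  (0 < m)%N -> uniq D -> {subset divisors m <= D} ->
  'X^m - 1 %| Cyclotomic_prod F D.
Proof.
move=> m_gt0 uniqD divD.
have perm_div : perm_eq (divisors m) [seq d <- D | d \in divisors m].
  apply: uniq_perm; rewrite ?divisors_uniq ?filter_uniq // => d.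
  by rewrite mem_filter andb_idr //; apply: divD.
rewrite /Cyclotomic_prod (bigID (mem (divisors m))) /= -big_filter.
rewrite -(perm_big _ perm_div) prod_Cyclotomic // rmorphM rmorphB /= map_polyXn rmorph1.
exact: dvdp_mulIl.
Qed.

Lemma divisors_sub_divisors_union k (n : 'I_k -> nat) s :
  {subset divisors (n s) <= divisors_union n}.
Proof.
move=> d d_dvd; rewrite mem_undup; apply/flattenP; exists (divisors (n s)) => //.
by apply: map_f; rewrite mem_enum.
Qed.

Theorem theorem1p1 (F : fieldType) (p : nat)
    (hp : has_characteristic F p)
    (k : nat) (n : 'I_k -> nat) (psi : 'I_k -> int -> F)
    (hn_gt0 : forall s : 'I_k, (0 < n s)%N)
    (hn_ndvd : forall s : 'I_k, ~~ (p %| n s)%N)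
    (hpsi : forall s : 'I_k, periodic (psi s) (n s))
    (a : int)
    (hvanish : forall i : nat,
      (i < \sum_(d <- divisors_union n) totient d)%N ->
      \sum_(s < k) psi s (a + i%:Z) = 0) :
  forall x : int, \sum_(s < k) psi s x = 0.
Proof.
move=> x; pose f y := \sum_(s < k) psi s y; rewrite -/(f x).
pose P := Cyclotomic_prod F (divisors_union n).
pose M := (\prod_(s < k) n s)%N.
have M_neq0 : M%:Z != 0 by rewrite eqz_nat -lt0n prodn_gt0.
have size_P := size_Cyclotomic_prod F (divisors_union n).
have dvd_P s : 'X^(n s) - 1 %| P.
  apply: Xn_sub_1_dvd_Cyclotomic_prod; rewrite ?undup_uniq //.
  exact: divisors_sub_divisors_union.
(* Move x by a multiple of the period M to a point a + m with m a natural number. *)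
have [m def_m] : exists m : nat, ((x - a) %% M%:Z)%Z = m%:Z.
  by exists `|((x - a) %% M%:Z)%Z|%N; rewrite gez0_abs // modz_ge0.
have -> : f x = f (a + m%:Z).
  rewrite -(@periodic_mulz F f M (a + m%:Z) ((x - a) %/ M%:Z)%Z (periodic_sum hpsi)).
  by rewrite -def_m -addrA [_ + _ * _]addrC -divz_eq addrC subrK.
rewrite -shift_eval_Xn (divp_eq 'X^m P) linearD /= (shift_eval_sum_periodic _ hpsi); last first.
  by move=> s; apply: dvdp_mull.
rewrite add0r /shift_eval big1 // => i _; rewrite /f hvanish ?mulr0 //.
apply: leq_trans (ltn_ord i) _; rewrite -ltnS -size_P.
by rewrite ltn_modp -size_poly_gt0 size_P.
Qed.
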